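(* Let $G$ and $H$ be compactly generated, locally compact second countable groups. Then $G$ and $H$ are quasi-isometric if and only if they admit a topological coupling.
   Context: Topological groups are Hausdorff, as usual. A locally compact group $G$ is compactly generated if $G=\langle K\rangle$ for some compact set $K\subseteq G$, which may be taken symmetric ($K=K^{-1}$). Quasi-isometry of metric spaces: a map $\phi\colon X\to Y$ between metric spaces is a quasi-isometry if $\sup_{y\in Y}d(y,\phi[X])<\infty$ and there are constants $L\geqslant 1$ and $C\geqslant 0$ such that $\frac1L d(x,z)-C\leqslant d(\phi(x),\phi(z))\leqslant L\,d(x,z)+C$ for all $x,z\in X$. The map $\phi$ is not required to be continuous. Quasi-isometry of groups: for a symmetric compact generating set $K$ of $G$, let $\rho_K$ be the left-invariant word metric on $G$ induced by $K$, i.e. $\rho_K(g,f)$ is the least $n\geqslant 0$ such that $g^{-1}f$ is a product of $n$ elements of $K$. Any two symmetric compact generating sets induce quasi-isometric word metrics (via the identity map). Two compactly generated, locally compact second countable groups $G$ and $H$ are quasi-isometric if there is a quasi-isometry between them when each is equipped with the word metric of some symmetric compact generating set; this does not depend on the choice of generating sets. Topological coupling: a topological coupling of locally compact groups $G$ and $H$ is a pair $G\curvearrowright X\curvearrowleft H$ consisting of a left action of $G$ and a right action of $H$ on a nonempty locally compact Hausdorff space $X$ that commute, i.e. $(g\cdot x)\cdot h=g\cdot(x\cdot h)$, and such that both actions are: - continuous: the maps $G\times X\to X$ and $X\times H\to X$ are jointly continuous; - proper: for every compact $K\subseteq X$, the sets $\{g\in G\mid gK\cap K\neq\emptyset\}$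 and $\{h\in H\mid Kh\cap K\neq\emptyset\}$ are compact; - cocompact: there is a compact $K\subseteq X$ with $X=G\cdot K=K\cdot H$. *)

(* Defs.v *)
From HB Require Import structures.
From mathcomp Require Import all_boot all_order all_algebra.
From mathcomp Require Import all_classical all_reals all_analysis.

Set Implicit Arguments.
Unset Strict Implicit.
Unset Printing Implicit Defensive.

Import Order.TTheory GRing.Theory Num.Theory.
Local Open Scope classical_set_scope.
Local Open Scope group_scope.

HB.mixin Record Group_isTopologicalGroup G & Topological G & Group G := {
  mulg_continuous : continuous (fun xy : G * G => xy.1 * xy.2) ;
  invg_continuous : continuous (fun x : G => x^-1)
}.

(* Separation is not part of the structure; the Hausdorff condition is stated
   as a hypothesis where it is needed. *)
#[short(type="topologicalGroupType")]
HB.structure Definition TopologicalGroup :=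
  {G of Topological G & Group G & Group_isTopologicalGroup G}.

Section Generation.
Context {G : groupType}.
Implicit Types (K S : set G) (g : G).

Definition subgroup_set S :=
  [/\ S 1, forall x y, S x -> S y -> S (x * y) & forall x, S x -> S x^-1].

Definition generates K := smallest subgroup_set K = [set: G].

Definition symmetric_set K := [set x^-1 | x in K] = K.

Definition word_product K (n : nat) : set G :=
  [set \prod_(i < n) k i | k in [set k : 'I_n -> G | forall i, K (k i)]].

(* The default value 0 of xget is only reached outside of the subgroup
   generated by a symmetric K: see word_lengthP. *)
Definition word_length K g : nat :=
  xget 0%N [set n | word_product K n g /\
                    forall m, word_product K m g -> (n <= m)%N].

Definition word_dist K g f : nat := word_length K (g^-1 * f).

Lemma word_product0 K g : word_product K 0 g <-> g = 1.
Proof.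
split=> [[k _ <-]|->]; first by rewrite big_ord0.
by exists (fun=> 1) => [[]//|]; rewrite big_ord0.
Qed.

Lemma word_product1 K g : K g -> word_product K 1 g.
Proof. by move=> Kg; exists (fun=> g) => //; rewrite big_ord1. Qed.

Lemma word_productM K m n g f : word_product K m g -> word_product K n f ->
  word_product K (m + n) (g * f).
Proof.
move=> [k Kk <-] [l Kl <-].
exists (fun i => match fintype.split i with inl j => k j | inr j => l j end) => /=.
  by move=> i; case: (fintype.split i).
rewrite big_split_ord/=; congr (_ * _); apply: eq_bigr => i _.
  by rewrite (unsplitK (inl i)).
by rewrite (unsplitK (inr i)).
Qed.

Lemma word_productV K n g : symmetric_set K -> word_product K n g ->
  word_product K n g^-1.
Proof.
move=> Ksym; elim: n g => [g /word_product0 ->|n IHn g [k Kk <-]].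
  by apply/word_product0; rewrite invg1.
rewrite big_ord_recl invgM -[in word_product _ n.+1]addn1.
apply: word_productM.
  by apply: IHn; exists (fun i => k (lift ord0 i)) => //= i; exact: Kk.
by apply: word_product1; rewrite -Ksym; exists (k ord0).
Qed.

Lemma generates_word K g : symmetric_set K -> generates K ->
  exists n, word_product K n g.
Proof.
move=> Ksym Kgen; have : [set: G] g by [].
rewrite -Kgen => /(_ [set g | exists n, word_product K n g]); apply.
split; last by move=> x /word_product1; exists 1%N.
split; first by exists 0%N; apply/word_product0.
- by move=> x y [m xm] [n yn]; exists (m + n)%N; exact: word_productM.
- by move=> x [m xm]; exists m; exact: word_productV.
Qed.

Lemma word_lengthP K g : symmetric_set K -> generates K ->
  word_product K (word_length K g) g /\
  forall n, word_product K n g -> (word_length K g <= n)%N.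
Proof.
move=> Ksym Kgen; rewrite /word_length; case: xgetP => [n _ //|nomin].
have [n gn] := generates_word g Ksym Kgen; exfalso.
have exP : exists n, `[< word_product K n g >] by exists n; apply/asboolP.
case: (ex_minnP exP) => m /asboolP gm mmin; apply: (nomin m); split => // l gl.
by apply: mmin; apply/asboolP.
Qed.

End Generation.

(* The group carrying, instead of its own topology, the metric structure of the
   word metric. *)
Definition word_space (R : realType) (G : groupType) (K : set G)
  (Ksym : symmetric_set K) (Kgen : generates K) : Type := G.

Section WordMetric.
Context {R : realType} {G : groupType} {K : set G}.
Hypotheses (Ksym : symmetric_set K) (Kgen : generates K).
Local Notation W := (word_space R Ksym Kgen).

Let dist (g f : W) : R := (word_dist K (g : G) (f : G))%:R%R.

Let distxx g : dist g g = 0%R.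
Proof.
apply/eqP; rewrite pnatr_eq0 -leqn0; apply: (word_lengthP _ Ksym Kgen).2.
by rewrite mulVg; apply/word_product0.
Qed.

Let dist_positivity g f : dist g f = 0%R -> g = f.
Proof.
move/eqP; rewrite pnatr_eq0 => /eqP d0.
have := (word_lengthP ((g : G)^-1 * (f : G)) Ksym Kgen).1.
rewrite -[word_length _ _]/(word_dist K _ _) d0 => /word_product0 gf.
by rewrite -[LHS](mulg1 (g : G)) -gf mulVKg.
Qed.

Let dist_le g f : (word_dist K (f : G) (g : G) <= word_dist K (g : G) (f : G))%N.
Proof.
apply: (word_lengthP _ Ksym Kgen).2.
rewrite -[X in word_product _ _ X]invgK invgM invgK.
by apply: word_productV => //; exact: (word_lengthP _ Ksym Kgen).1.
Qed.

Let dist_sym g f : dist g f = dist f g.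
Proof. by apply/eqP; rewrite eqr_nat eqn_leq !dist_le. Qed.

Let dist_triangle f g h : (dist g h <= dist g f + dist f h)%R.
Proof.
rewrite -natrD ler_nat; apply: (word_lengthP _ Ksym Kgen).2.
have -> : (g : G)^-1 * (h : G) =
    ((g : G)^-1 * (f : G)) * ((f : G)^-1 * (h : G)) by rewrite -mulgA mulVKg.
by apply: word_productM; exact: (word_lengthP _ Ksym Kgen).1.
Qed.

HB.instance Definition _ := Choice.copy W G.
HB.instance Definition _ := isMetric.Build R W
  distxx dist_positivity dist_sym dist_triangle.

Lemma word_mdistE (g f : W) : mdist g f = (word_dist K (g : G) (f : G))%:R%R.
Proof. by []. Qed.

End WordMetric.

Definition quasi_isometry (R : realType) (X Y : metricType R) (phi : X -> Y) :=
  (ereal_sup [set ereal_inf [set (mdist y (phi x))%:E | x in [set: X]]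
             | y in [set: Y]] < +oo)%E /\
  (exists L C : R, [/\ 1 <= L, 0 <= C &
    forall x z, L^-1 * mdist x z - C <= mdist (phi x) (phi z)
                /\ mdist (phi x) (phi z) <= L * mdist x z + C])%R.

Definition compactly_generated (G : topologicalGroupType) :=
  exists2 K : set G, compact K & generates K.

Definition quasi_isometric (R : realType) (G H : topologicalGroupType) :=
  exists (K : set G) (Ksym : symmetric_set K) (Kgen : generates K)
         (L : set H) (Lsym : symmetric_set L) (Lgen : generates L),
    [/\ compact K, compact L &
        exists phi : word_space R Ksym Kgen -> word_space R Lsym Lgen,
          quasi_isometry phi].

Definition is_left_action (G : groupType) (X : Type) (act : G -> X -> X) :=
  (forall x, act 1 x = x) /\ (forall g f x, act (g * f) x = act g (act f x)).

Definition is_right_action (H : groupType) (X : Type) (act : X -> H -> X) :=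
  (forall x, act x 1 = x) /\ (forall x h k, act x (h * k) = act (act x h) k).

Record topological_coupling (G H : topologicalGroupType) (X : topologicalType)
    (lact : G -> X -> X) (ract : X -> H -> X) : Prop := {
  coupling_nonempty : [set: X] !=set0 ;
  coupling_hausdorff : hausdorff_space X ;
  coupling_locally_compact : locally_compact [set: X] ;
  coupling_left : is_left_action lact ;
  coupling_right : is_right_action ract ;
  coupling_commute : forall g x h, ract (lact g x) h = lact g (ract x h) ;
  coupling_lcontinuous : continuous (fun gx : G * X => lact gx.1 gx.2) ;
  coupling_rcontinuous : continuous (fun xh : X * H => ract xh.1 xh.2) ;
  coupling_lproper : forall K : set X, compact K ->
    compact [set g | [set lact g x | x in K] `&` K !=set0] ;
  coupling_rproper : forall K : set X, compact K ->
    compact [set h | [set ract x h | x in K] `&` K !=set0] ;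
  coupling_cocompact : exists K : set X,
    [/\ compact K,
        [set lact g x | g in [set: G] & x in K] = [set: X] &
        [set ract x h | x in K & h in [set: H]] = [set: X]]
}.

(* Main.v *)
(* Both properties are equivalent to the existence of a coarse correspondence: a
   relation F between G and H, total on both sides, such that a^-1 * a' stays in
   a compact set exactly when c^-1 * c' does, for F a c and F a' c'.

   A quasi-isometry phi gives such a relation, c at word distance at most D from
   phi a; conversely a correspondence is Lipschitz along words.  This uses that
   compact sets have bounded word length, by the Baire category theorem applied
   to the (compact) balls of the word metric.

   A coupling gives the correspondence a^-1 x0 c \in K, for a compact fundamental
   domain K of both actions.  For the converse, thicken F to a left uniformly
   continuous f0 : G * H -> [0, 1] with f0 = 1 on F, supported in F N with N
   compact.  The coupling space consists of the nonzero functions f satisfying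
   the translation invariant, pointwise closed conditions satisfied by f0, with
   the topology of pointwise convergence and (g f h)(s, t) = f(g^-1 s, h t).  By
   Tychonoff it is an open subset of a compact space; the common modulus of
   continuity makes the action jointly continuous; the bounds on the support of f
   give properness, and the fact that f is somewhere at least 1/2 on each vertical
   and each horizontal line gives cocompactness. *)

Require Import Defs.
From HB Require Import structures.
From mathcomp Require Import all_boot all_order all_algebra.
From mathcomp Require Import all_classical all_reals all_analysis.
From mathcomp Require Import zify lra.

Set Implicit Arguments.
Unset Strict Implicit.
Unset Printing Implicit Defensive.

Import Order.TTheory GRing.Theory Num.Theory.
Import numFieldNormedType.Exports.
Local Open Scope classical_set_scope.
Local Open Scope group_scope.

(** * Baire category in locally compact spaces *)

Lemma locally_compact_nbhs (T : topologicalType) (x : T) :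
  locally_compact [set: T] -> exists2 V, nbhs x V & compact V /\ closed V.
Proof.
move=> /(_ x I) [V xV cV]; exists V => //.
by have : nbhs x [set y | [set: T] y -> V y] by []; apply: filterS => y; apply.
Qed.

(** If no [F n] had interior, shrinking neighbourhoods could dodge the sets [F n] one after the
    other, and compactness would give a point lying in none of them. *)
Lemma baire_closed_cover (T : topologicalType) (F : nat -> set T) (x0 : T) :
  hausdorff_space T -> locally_compact [set: T] ->
  (forall n, closed (F n)) -> (forall x, exists n, F n x) ->
  exists n (x : T), nbhs x (F n).
Proof.
move=> hT lT clF covF; apply: contrapT => noint.
have nF n (x : T) : ~ nbhs x (F n) by move=> Fx; apply: noint; exists n, x.
(* The state carries a stage [n] and a pointed neighbourhood [V]. As [F n] is not a neighbourhood of
   any point, it misses some [z] in the interior of [V], and regularity shrinks [V] around [z] to a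
   set whose closure avoids [F n]. *)
have step (s : nat * {yV : T * set T | nbhs yV.1 yV.2}) :
    {t : nat * {yV : T * set T | nbhs yV.1 yV.2} | t.1 = s.1.+1 /\
      closure (sval t.2).2 `<=` (sval s.2).2 `\` F s.1}.
  apply: cid; case: s => n [[y V] /= yV].
  have [z [Vz nFz]] : exists z, V° z /\ ~ F n z.
    apply: contrapT => nz; apply: (nF n y).
    apply: filterS (nbhs_interior yV) => z Vz.
    by apply: contrapT => nFz; apply: nz; exists z.
  have [K zK [cK _]] := locally_compact_nbhs z lT.
  have [W zW Wsub] : filter_from (nbhs z) closure (V `\` F n).
    apply: (compact_regular hT cK zK); apply: filterI => //.
    by apply: open_nbhs_nbhs; split => //; rewrite openC.
  by exists (n.+1, exist _ (z, W) zW).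
have [K xK [cK clK]] := locally_compact_nbhs x0 lT.
have [f [f0 fS]] := dependent_choice step (0%N, exist _ (x0, K) xK).
pose y n := (sval (f n).2).1; pose V n := (sval (f n).2).2.
have yV n : nbhs (y n) (V n) by exact: (proj2_sig (f n).2).
have fn n : (f n).1 = n by elim: n => [|n IH]; rewrite ?f0// (fS n).1 IH.
have VS n : closure (V n.+1) `<=` V n `\` F n.
  by have := (fS n).2; rewrite fn.
have Vle m n : (m <= n)%N -> V n `<=` V m.
  move=> /subnK <-; elim: (n - m)%N => // k IH z Vz; apply: IH.
  by apply: (VS _ _ _).1; exact: subset_closure.
(* A cluster point of the centres lies in the closure of every [V n.+1], hence outside every
   [F n]. *)
have [|z [_ zcl]] := cK (y @ \oo).
  exists 0%N => // n _; have -> : K = V 0%N by rewrite /V f0.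
  by apply: (Vle 0%N n) => //; exact: nbhs_singleton.
have [n Fz] := covF z; apply: (VS n z _).2 Fz => U zU.
apply: zcl zU; exists n.+1 => // m /= nm.
by apply: (Vle n.+1 m) => //; exact: nbhs_singleton.
Qed.

(** * Compact sets in topological groups *)

Section TopologicalGroups.
Context {G : topologicalGroupType}.
Implicit Types (A B K : set G) (g : G).

Lemma cvgMg (T : Type) (F : set_system T) (f h : T -> G) (a b : G) :
  Filter F -> f @ F --> a -> h @ F --> b -> (fun t => f t * h t) @ F --> a * b.
Proof.
by move=> FF fa hb; apply: continuous2_cvg fa hb; exact: (mulg_continuous (a, b)).
Qed.

Lemma cvgVg (T : Type) (F : set_system T) (f : T -> G) (a : G) :
  Filter F -> f @ F --> a -> (fun t => (f t)^-1) @ F --> a^-1.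
Proof. by move=> FF fa; apply: cvg_comp fa _; exact: invg_continuous. Qed.

Lemma compactM A B : compact A -> compact B ->
  compact [set a * b | a in A & b in B].
Proof.
move=> cA cB.
have -> : [set a * b | a in A & b in B] =
    (fun ab : G * G => ab.1 * ab.2) @` (A `*` B).
  apply/seteqP; split=> [_ [a Aa [b Bb <-]]|_ [[a b] [Aa Bb] <-]].
    by exists (a, b).
  by exists a => //; exists b.
apply: continuous_compact; last exact: compact_setX.
by apply: continuous_subspaceT; exact: mulg_continuous.
Qed.

Lemma compactV A : compact A -> compact [set a^-1 | a in A].
Proof.
apply: continuous_compact.
by apply: continuous_subspaceT; exact: invg_continuous.
Qed.

Lemma nbhsVM g (V : set G) : nbhs 1 V -> \forall x \near g, V (g^-1 * x).
Proof.
move=> V1; suff : (fun x => g^-1 * x) @ g --> (1 : G) by exact.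
by rewrite -(mulVg g); apply: cvgMg; [exact: cvg_cst|exact: cvg_id].
Qed.

(* The filter of tails makes a near covering select a finite net. *)
Lemma compact_finite_net A (V : set G) : compact A -> nbhs 1 V ->
  exists s : seq G, forall a, A a -> exists2 v, v \in s & V (v^-1 * a).
Proof.
move=> /compact_near_coveringP cA V1.
pose F := filter_from [set: seq G] (fun s => [set t : seq G | {subset s <= t}]).
have FF : Filter F.
  apply: filter_from_filter; first by exists [::].
  move=> s t _ _; exists (s ++ t) => // u /= sub; split=> x xs;
  by apply: sub; rewrite mem_cat xs ?orbT.
have [|s _ /(_ s)] := cA _ F (fun s a => exists2 v, v \in s & V (v^-1 * a)) FF.
  move=> a Aa; exists ([set b | V (a^-1 * b)], [set s | a \in s]) => /=.
    split; first exact: nbhsVM.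
    by exists [:: a] => // s /= sub; apply: sub; rewrite inE.
  by move=> [b s] [/= Vb sa]; exists a.
by move=> As; exists s => a Aa; exact: As.
Qed.

End TopologicalGroups.

(** * Word metrics *)

Section WordBalls.
Context {G : topologicalGroupType} {K : set G}.
Hypotheses (Ksym : symmetric_set K) (Kgen : generates K).

Lemma word_length_le n g : word_product K n g -> (word_length K g <= n)%N.
Proof. exact: (word_lengthP g Ksym Kgen).2. Qed.

Lemma word_length1 : word_length K 1 = 0%N.
Proof. by apply/eqP; rewrite -leqn0; apply: word_length_le; exact/word_product0. Qed.

Lemma word_lengthM g h :
  (word_length K (g * h) <= word_length K g + word_length K h)%N.
Proof.
by apply: word_length_le; apply: word_productM;
  exact: (word_lengthP _ Ksym Kgen).1.
Qed.

Lemma word_lengthV g : (word_length K g^-1 <= word_length K g)%N.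
Proof.
by apply: word_length_le; apply: word_productV => //;
  exact: (word_lengthP _ Ksym Kgen).1.
Qed.

Lemma word_productS n g : word_product K n.+1 g ->
  exists2 k, K k & exists2 h, word_product K n h & k * h = g.
Proof.
move=> [k Kk <-]; rewrite big_ord_recl; exists (k ord0) => //.
exists (\prod_(i < n) k (lift ord0 i)) => //.
by exists (fun i => k (lift ord0 i)) => // i; exact: Kk.
Qed.

Lemma word_product_compact n : compact K -> compact (word_product K n).
Proof.
move=> cK; elim: n => [|n IH].
  have -> : word_product K 0 = [set 1] by apply/seteqP; split=> g /word_product0.
  exact: compact_set1.
suff -> : word_product K n.+1 = [set k * g | k in K & g in word_product K n].
  exact: compactM.
apply/seteqP; split=> [g /word_productS //|_ [k Kk [g gn <-]]].
by rewrite -add1n; apply: word_productM => //; exact: word_product1.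
Qed.

Lemma word_ball_compact n : compact K ->
  compact [set g | (word_length K g <= n)%N].
Proof.
move=> cK.
have -> : [set g | (word_length K g <= n)%N] =
    \big[setU/set0]_(i < n.+1) word_product K i.
  apply/seteqP; split=> [g /= gn|g].
    rewrite -(bigcup_mkord n.+1 (word_product K)).
    by exists (word_length K g) => //; exact: (word_lengthP _ Ksym Kgen).1.
  rewrite -(bigcup_mkord n.+1 (word_product K)) => -[i /= iN /word_length_le gi].
  exact: leq_trans gi _.
by apply: bigsetU_compact => i _; exact: word_product_compact.
Qed.

(** The balls [B n] are closed and cover [G], so by Baire some [B n] is a neighbourhood of a point
    [x]. Writing [y = x^-1 * (x * y)] makes [B (n + n)] a neighbourhood of 1, and finitely many
    translates of it cover [A]. *)
Lemma compact_word_length_bounded (A : set G) : hausdorff_space G ->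
  locally_compact [set: G] -> compact K -> compact A ->
  exists n, forall a, A a -> (word_length K a <= n)%N.
Proof.
move=> hG lG cK cA; pose B n := [set g | (word_length K g <= n)%N].
have clB n : closed (B n) by apply: compact_closed => //; exact: word_ball_compact.
have [n [x nx]] := baire_closed_cover (1 : G) hG lG clB
  (fun g => ex_intro _ (word_length K g) (leqnn _)).
have B1 : nbhs 1 (B (n + n)%N).
  have : \forall y \near (1 : G), B n (x * y).
    suff : (fun y => x * y) @ (1 : G) --> x by exact.
    by rewrite -[X in _ --> X](mulg1 x); apply: cvgMg; [exact: cvg_cst|exact: cvg_id].
  apply: filterS => y Bxy; rewrite /B /= -(mulKg x y).
  apply: leq_trans (word_lengthM _ _) _; apply: leq_add => //.
  by apply: leq_trans (word_lengthV _) _; exact: (nbhs_singleton nx).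
have [s As] := compact_finite_net cA B1.
exists (\max_(v <- s) word_length K v + (n + n))%N => a /As [v vs va].
rewrite -(mulVKg v a); apply: leq_trans (word_lengthM _ _) _.
by rewrite leq_add//; exact: leq_bigmax_seq.
Qed.

End WordBalls.

Lemma compactly_generated_symmetric (G : topologicalGroupType) :
  compactly_generated G ->
  exists K : set G, [/\ symmetric_set K, generates K & compact K].
Proof.
move=> [K cK Kgen]; exists (K `|` [set x^-1 | x in K]); split.
- apply/seteqP; split=> [_ [x [Kx|[y Ky <-]] <-]|x [Kx|[y Ky <-]]].
  + by right; exists x.
  + by left; rewrite invgK.
  + by exists x^-1; [right; exists x|rewrite invgK].
  + by exists y => //; left.
- apply/seteqP; split=> // g _ S [Ssub KS].
  have : [set: G] g by []; rewrite -Kgen; apply; split=> // x Kx.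
  by apply: KS; left.
- by apply: compactU => //; exact: compactV.
Qed.

(** * Coarse correspondences *)

(** Compact sets play the role of bounded sets, so this is bornologous control for the
    left-invariant coarse structures. With [1] in [A] it also bounds the spread of the points
    related to a single [a]. *)
Definition controlled (G H : topologicalGroupType) (F : G -> H -> Prop) :=
  forall A : set G, compact A -> exists2 B : set H, compact B &
    forall a a' c c', F a c -> F a' c' -> A (a^-1 * a') -> B (c^-1 * c').

Record coarse_correspondence (G H : topologicalGroupType) (F : G -> H -> Prop) :
    Prop := {
  corr_total : forall a, exists c, F a c ;
  corr_onto : forall c, exists a, F a c ;
  corr_controlled : controlled F ;
  corr_cocontrolled : controlled (fun c a => F a c)
}.

(** Follow a shortest word from [a] to [a'] and pick a related point after each letter; each letter
    moves that point by an element of [B], of length at most [M]. At the end two points are related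
    to the same [a']: this is why 1 is adjoined to [K], and it accounts for the successor. *)
Lemma controlled_word_dist (G H : topologicalGroupType) (F : G -> H -> Prop)
    (K : set G) (L : set H) : hausdorff_space H -> locally_compact [set: H] ->
  symmetric_set K -> generates K -> compact K ->
  symmetric_set L -> generates L -> compact L ->
  (forall a, exists c, F a c) -> controlled F ->
  exists M, forall a a' c c', F a c -> F a' c' ->
    (word_dist L c c' <= M * (word_dist K a a').+1)%N.
Proof.
move=> hH lH Ksym Kgen cK Lsym Lgen cL Ft FC.
have [B cB FB] := FC _ (compactU cK (@compact_set1 _ (1 : G))).
have [M BM] := compact_word_length_bounded Lsym Lgen hH lH cL cB.
exists M => a a' c c' Fac Fac'.
have := (word_lengthP (a^-1 * a') Ksym Kgen).1; rewrite -/(word_dist K a a').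
move: (word_dist K a a') => n; elim: n a c Fac => [|n IH] a c Fac.
  move=> /word_product0 aa'; rewrite muln1; apply: BM.
  by apply: FB Fac Fac' _; right.
move=> /word_productS [k Kk [g gn kg]].
have [d Fd] := Ft (a * k).
have /IH -/(_ _ Fd) dd : word_product K n ((a * k)^-1 * a').
  by rewrite invgM -mulgA -kg mulKg.
rewrite mulnS /word_dist -(mulVKg d c') mulgA.
apply: leq_trans (word_lengthM Lsym Lgen _ _) _.
by apply: leq_add => //; apply/BM/(FB _ _ _ _ Fac Fd); left; rewrite mulKg.
Qed.

(** * Correspondences and quasi-isometries *)

Section CorrespondenceQuasiIsometry.
Context {R : realType} {G H : topologicalGroupType}.
Hypotheses (hG : hausdorff_space G) (hH : hausdorff_space H).
Hypotheses (lG : locally_compact [set: G]) (lH : locally_compact [set: H]).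

(** Any function chosen inside [F] works. Two points related to the same [x] are at distance at most
    [M1], so [Fo] makes the image coarsely dense. *)
Lemma correspondence_quasi_isometric (F : G -> H -> Prop) :
  compactly_generated G -> compactly_generated H ->
  coarse_correspondence F -> quasi_isometric R G H.
Proof.
move=> /compactly_generated_symmetric [K [Ksym Kgen cK]].
move=> /compactly_generated_symmetric [L [Lsym Lgen cL]] [Ft Fo FC FcC].
have [M1 FM1] := controlled_word_dist hH lH Ksym Kgen cK Lsym Lgen cL Ft FC.
have [M2 FM2] := controlled_word_dist hG lG Lsym Lgen cL Ksym Kgen cK Fo FcC.
exists K, Ksym, Kgen, L, Lsym, Lgen; split=> //.
have [phi Fphi] := choice Ft; exists phi; split.
  apply: (@le_lt_trans _ _ (M1%:R : R)%:E); last exact: ltry.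
  apply: ge_ereal_sup => _ [y _ <-].
  have [x Fxy] := Fo y;
  apply: (@le_trans _ _ (mdist (y : word_space R Lsym Lgen) (phi x))%:E).
    by apply: ereal_inf_lbound; exists x.
  rewrite word_mdistE lee_fin ler_nat.
  apply: leq_trans (FM1 _ _ _ _ Fxy (Fphi x)) _.
  by rewrite /word_dist mulVg word_length1 ?muln1.
(* One constant serves both as factor and as additive error; the successor makes it at least 1. *)
pose N := (M1 + M2).+1; exists N%:R%R, N%:R%R; split; first by rewrite ler1n.
  exact: ler0n.
move=> x z; rewrite !word_mdistE; split.
  rewrite lerBlDr ler_pdivrMl ?ltr0n// -natrD -natrM ler_nat.
  apply: leq_trans (FM2 _ _ _ _ (Fphi x) (Fphi z)) _.
  by rewrite leq_mul /N ?leqW ?leq_addl// -addn1 leq_add2l.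
rewrite -natrM -natrD ler_nat.
apply: leq_trans (FM1 _ _ _ _ (Fphi x) (Fphi z)) _.
by rewrite -mulnSr leq_mul2r /N leqW ?leq_addr ?orbT.
Qed.

Lemma quasi_isometric_correspondence : quasi_isometric R G H ->
  exists F : G -> H -> Prop, coarse_correspondence F.
Proof.
move=> [K [Ksym [Kgen [L [Lsym [Lgen [cK cL [phi [phis [q [C [q1 C0 phiq]]]]]]]]]]]].
(* [D] is taken strictly above the supremum, so that each infimum is beaten by an actual point
   [phi a]. *)
have [D phiD] : exists D : nat, forall c, exists a,
    (word_dist L c (phi a) <= D)%N.
  set s := ereal_sup _ in phis.
  have [D sD] : exists D : nat, (s < D%:R%:E)%E.
    move: s phis => [r _| |_] //; last by exists 0%N; rewrite ltNyr.
    by exists (Num.truncn r).+1; rewrite lte_fin truncnS_gt.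
  exists D => c; set S := [set (mdist (c : word_space R Lsym Lgen) (phi x))%:E
    | x in [set: word_space R Ksym Kgen]].
  have : (ereal_inf S < D%:R%:E)%E.
    by apply: le_lt_trans sD; apply: ereal_sup_ubound; exists c.
  move=> /ereal_inf_lt [_ [a _ <-]]; rewrite word_mdistE lte_fin ltr_nat.
  by exists a; exact: ltnW.
(* Moving both endpoints by at most [D] changes a distance by at most [D + D]. *)
have dL a c c' a' : (word_dist L c (phi a) <= D)%N ->
    (word_dist L c' (phi a') <= D)%N ->
    (word_dist L c c' <= word_dist L (phi a) (phi a') + (D + D))%N /\
    (word_dist L (phi a) (phi a') <= word_dist L c c' + (D + D))%N.
  move=> ca ca'; have cV d e : (word_dist L d e <= word_dist L e d)%N.
    rewrite /word_dist -[X in word_length _ X]invgK invgM invgK.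
    exact: word_lengthV.
  have cT d e f : (word_dist L d f <= word_dist L d e + word_dist L e f)%N.
    rewrite /word_dist; have -> : d^-1 * f = (d^-1 * e) * (e^-1 * f).
      by rewrite -mulgA mulVKg.
    exact: word_lengthM.
  have := cT c (phi a) c'; have := cT (phi a) (phi a') c'.
  have := cT (phi a) c (phi a'); have := cT c c' (phi a').
  have := cV (phi a') c'; have := cV (phi a) c; lia.
exists (fun a c => (word_dist L c (phi a) <= D)%N); split.
- by move=> a; exists (phi a); rewrite /word_dist mulVg word_length1.
- exact: phiD.
- move=> A cA.
  have [m Am] := compact_word_length_bounded Ksym Kgen hG lG cK cA.
  pose N := (Num.truncn (q * m%:R + C)%R).+1.
  exists [set h | (word_length L h <= N + (D + D))%N].
    exact: word_ball_compact.
  move=> a a' c c' ca ca' /Am am.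
  apply: leq_trans (dL _ _ _ _ ca ca').1 _; rewrite leq_add2r.
  have := (phiq a a').2; rewrite !word_mdistE => phile.
  rewrite -(ler_nat R); apply: le_trans phile _; apply: le_trans (ltW (truncnS_gt _)).
  by rewrite lerD2r ler_pM2l ?ler_nat// (lt_le_trans _ q1).
- move=> A cA.
  have [m Am] := compact_word_length_bounded Lsym Lgen hH lH cL cA.
  (* This bound solves the lower quasi-isometry inequality for the distance in [G]. *)
  pose N := (Num.truncn (q * ((m + (D + D))%:R + C))%R).+1.
  exists [set h | (word_length K h <= N)%N].
    exact: word_ball_compact.
  move=> c c' a a' ca ca' /Am cm.
  have := (phiq a a').1; rewrite !word_mdistE => phige.
  rewrite /= -(ler_nat R); apply: le_trans (ltW (truncnS_gt _)).
  rewrite -ler_pdivrMl ?(lt_le_trans _ q1)// -lerBlDr.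
  apply: le_trans phige _; rewrite ler_nat.
  by apply: leq_trans (dL _ _ _ _ ca ca').2 _; rewrite leq_add2r.
Qed.

End CorrespondenceQuasiIsometry.

(** * Correspondences from couplings *)

Section CouplingCorrespondence.
Context {G H : topologicalGroupType} {X : topologicalType}.
Context {lact : G -> X -> X} {ract : X -> H -> X}.
Hypothesis coup : topological_coupling lact ract.

Lemma compact_lact (A : set G) (K : set X) : compact A -> compact K ->
  compact [set lact a x | a in A & x in K].
Proof.
move=> cA cK.
have -> : [set lact a x | a in A & x in K] =
    (fun ax : G * X => lact ax.1 ax.2) @` (A `*` K).
  apply/seteqP; split=> [_ [a Aa [x Kx <-]]|_ [[a x] [Aa Kx] <-]].
    by exists (a, x).
  by exists a => //; exists x.
apply: continuous_compact; last exact: compact_setX.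
by apply: continuous_subspaceT; exact: coupling_lcontinuous coup.
Qed.

Lemma compact_ract (K : set X) (A : set H) : compact K -> compact A ->
  compact [set ract x a | x in K & a in A].
Proof.
move=> cK cA.
have -> : [set ract x a | x in K & a in A] =
    (fun xa : X * H => ract xa.1 xa.2) @` (K `*` A).
  apply/seteqP; split=> [_ [x Kx [a Aa <-]]|_ [[x a] [Kx Aa] <-]].
    by exists (x, a).
  by exists x => //; exists a.
apply: continuous_compact; last exact: compact_setX.
by apply: continuous_subspaceT; exact: coupling_rcontinuous coup.
Qed.

Lemma coupling_correspondence :
  exists F : G -> H -> Prop, coarse_correspondence F.
Proof.
have [l1 lM] := coupling_left coup; have [r1 rM] := coupling_right coup.
have lr := coupling_commute coup.
have [x0 _] := coupling_nonempty coup.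
have [K [cK GK KH]] := coupling_cocompact coup.
exists (fun a c => K (ract (lact a^-1 x0) c)); split.
- move=> a; have : [set: X] (lact a^-1 x0) by [].
  rewrite -KH => -[k Kk [h _ kh]]; exists h^-1.
  by rewrite -kh -rM mulgV r1.
- move=> c; have : [set: X] (ract x0 c) by [].
  rewrite -GK => -[g _ [k Kk gk]]; exists g.
  by rewrite lr -gk -lM mulVg l1.
(* The point [a'^-1 x0 c] is obtained from [a^-1 x0 c] by [(a^-1 * a')^-1], so it lies in [A^-1 K];
   then [c^-1 * c'] carries it to [a'^-1 x0 c'] in [K]. Hence [c^-1 * c'] is a return element of
   [K']. *)
- move=> A cA; pose K' := K `|` [set lact a x | a in [set a^-1 | a in A] & x in K].
  have cK' : compact K' by apply: compactU cK (compact_lact (compactV cA) cK).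
  exists [set h | [set ract x h | x in K'] `&` K' !=set0].
    exact: coupling_rproper coup _ cK'.
  move=> a a' c c' Kc Kc' Aaa'; exists (ract (lact a'^-1 x0) c'); split; last by left.
  exists (lact (a^-1 * a')^-1 (ract (lact a^-1 x0) c)).
    by right; exists (a^-1 * a')^-1; [exists (a^-1 * a')|exists (ract (lact a^-1 x0) c)].
  by rewrite -lr -rM mulVKg -lM invgM invgK -mulgA mulgV mulg1.
(* Symmetrically, [a^-1 x0 c'] lies in [K A] and [a'^-1 * a] carries it into [K]. This bounds the
   inverse of [a^-1 * a'], whence the inverted return set. *)
- move=> A cA; pose K' := K `|` [set ract x a | x in K & a in A].
  have cK' : compact K' by apply: compactU cK (compact_ract cK cA).
  exists [set g^-1 | g in [set g | [set lact g x | x in K'] `&` K' !=set0]].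
    by apply: compactV; exact: coupling_lproper coup _ cK'.
  move=> c c' a a' Kc Kc' Acc'; exists (a'^-1 * a); last by rewrite invgM invgK.
  exists (ract (lact a'^-1 x0) c'); split; last by left.
  exists (ract (ract (lact a^-1 x0) c) (c^-1 * c')).
    by right; exists (ract (lact a^-1 x0) c) => //; exists (c^-1 * c').
  by rewrite -rM mulVKg -lr -lM -mulgA mulgV mulg1.
Qed.

End CouplingCorrespondence.

(** * Products of groups and bump functions *)

Section ProductGroup.
Variables G H : topologicalGroupType.

Let mulg_prod_continuous :
  continuous (fun xy : (G * H) * (G * H) => xy.1 * xy.2).
Proof.
move=> [p q]; apply: cvg_pair; apply: cvgMg.
- exact: (cvg_comp _ _ (cvg_fst) (cvg_fst)).
- exact: (cvg_comp _ _ (cvg_snd) (cvg_fst)).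
- exact: (cvg_comp _ _ (cvg_fst) (cvg_snd)).
- exact: (cvg_comp _ _ (cvg_snd) (cvg_snd)).
Qed.

Let invg_prod_continuous : continuous (fun x : G * H => x^-1).
Proof.
by move=> p; apply: cvg_pair; apply: cvgVg; [exact: cvg_fst|exact: cvg_snd].
Qed.

HB.instance Definition _ := Group_isTopologicalGroup.Build (G * H)%type
  mulg_prod_continuous invg_prod_continuous.

End ProductGroup.

Section ProductTopology.
Context {T U : topologicalType}.

Lemma locally_compact_setX : locally_compact [set: T] ->
  locally_compact [set: U] -> locally_compact [set: T * U].
Proof.
move=> lT lU [x y] _.
have [V xV [cV clV]] := locally_compact_nbhs x lT.
have [W yW [cW clW]] := locally_compact_nbhs y lU.
exists (V `*` W); first by rewrite withinET; exists (V, W).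
split; first exact: compact_setX.
have -> : V `*` W = fst @^-1` V `&` snd @^-1` W by [].
by apply: closedI; [apply: preimage_closed clV => p _; exact: cvg_fst
                   |apply: preimage_closed clW => p _; exact: cvg_snd].
Qed.

Lemma hausdorff_setX : hausdorff_space T -> hausdorff_space U ->
  hausdorff_space (T * U)%type.
Proof.
move=> hT hU [x y] [x' y'] xy; congr pair.
  apply: hT => A B xA xB.
  have [||[z w] [/= Az Bz]] := xy (A `*` setT) (B `*` setT).
  - by exists (A, setT) => //=; split=> //; exact: filterT.
  - by exists (B, setT) => //=; split=> //; exact: filterT.
  - by exists z; case: Az; case: Bz.
apply: hU => A B yA yB.
have [||[z w] [/= Az Bz]] := xy (setT `*` A) (setT `*` B).
- by exists (setT, A) => //=; split=> //; exact: filterT.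
- by exists (setT, B) => //=; split=> //; exact: filterT.
- by exists w; case: Az; case: Bz.
Qed.

End ProductTopology.

Local Open Scope ring_scope.

Section Bump.
Context {R : realType} {P : topologicalGroupType}.
Hypotheses (hP : hausdorff_space P) (lP : locally_compact [set: P]).

(** Perturbing on the right makes the condition invariant under left translation, so all left
    translates of [f] share one modulus. *)
Definition left_uniform (f : P -> R) := forall e : R, 0 < e ->
  \forall u \near (1%g : P), forall p, `|f (p * u)%g - f p| <= e.

(** Compactness makes the estimate uniform for [p] in [N]. When [p * u] is in [N] but [b p = 0], the
    estimate is applied at [p * u] with [u^-1]. *)
Lemma compact_support_left_uniform (b : P -> R) (N : set P) : continuous b ->
  compact N -> (forall p, b p != 0 -> N p) -> left_uniform b.
Proof.
move=> cb cN bN e e0.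
have {cN} near_N : \forall u \near (1%g : P), forall p, N p ->
    `|b (p * u)%g - b p| <= e.
  move: cN => /compact_near_coveringP.
  move=> /(_ _ (nbhs (1%g : P)) (fun u p => `|b (p * u)%g - b p| <= e) _); apply.
  move=> p _.
  suff : (fun q : P * P => b (q.1 * q.2)%g - b q.1) @ (p, 1%g : P) --> (0 : R).
    move=> /cvgr0_norm_le /(_ e e0); exact.
  rewrite -(subrr (b p)); apply: cvgB; last first.
    by apply: cvg_comp; [exact: cvg_fst|exact: cb].
  rewrite -[in X in _ --> X](mulg1 p); apply: (@cvg_comp _ _ _ _ b); last exact: cb.
  exact: (mulg_continuous (p, 1%g)).
have near_V : \forall u \near (1%g : P), forall p, N p ->
    `|b (p * u^-1)%g - b p| <= e.
  have : (fun u : P => u^-1)%g @ (1%g : P) --> (1%g : P).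
    by rewrite -[X in _ --> X]invg1; exact: invg_continuous.
  by move=> /(_ _ near_N).
near=> u => p.
have [bp|/bN Np] := eqVneq (b p) 0; last exact: (near near_N u).
have [bpu|/bN Npu] := eqVneq (b (p * u)%g) 0.
  by rewrite bp bpu subrr normr0 ltW.
rewrite distrC -[in X in `|X - _|](mulgK u p).
exact: (near near_V u).
Unshelve. all: by end_near. Qed.

Lemma bump_function : exists (b : P -> R) (N : set P),
  [/\ compact N, forall p, 0 <= b p <= 1, b 1%g = 1,
      forall p, b p != 0 -> N p & left_uniform b].
Proof.
have [V V1 [cV clV]] := locally_compact_nbhs (1%g : P) lP.
have : uniform_separator [set (1%g : P)] (~` V°).
  apply: (@locally_compact_completely_regular P R lP hP).
    by apply: open_closedC; exact: open_interior.
  by move=> /(_ V1).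
move=> /(@uniform_separatorP _ R) [f [cf f01 f1 fV]].
pose b p := 1 - f p.
have bV p : b p != 0 -> V p.
  apply: contraPP => nVp; apply/negP; rewrite negbK /b subr_eq0 eq_sym.
  by apply/eqP/fV; exists p => // /interior_subset.
have cb : continuous b.
  by move=> p; apply: cvgB; [exact: cvg_cst|exact: cf].
exists b, V; split=> //.
- move=> p; have : range f (f p) by exists p.
  by move=> /f01 /=; rewrite in_itv /= /b subr_ge0 lerBlDr lerDl andbC.
- by rewrite /b (f1 (f 1%g)) ?subr0//; exists 1%g.
- exact: compact_support_left_uniform bV.
Qed.

(** The supremum over [q] in [F] of the translates [b (q^-1 * p)] keeps the modulus of [b], because
    it is common to all of them. *)
Lemma thickened_indicator (F : set P) : F !=set0 ->
  exists (f : P -> R) (N : set P),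
  [/\ compact N, forall p, 0 <= f p <= 1, forall q, F q -> f q = 1,
      forall p, f p != 0 -> exists2 q, F q & N (q^-1 * p)%g & left_uniform f].
Proof.
move=> [q0 Fq0]; have [b [N [cN b01 b1 bN bu]]] := bump_function.
pose S p := [set b (q^-1 * p)%g | q in F]; pose f p := sup (S p).
have S0 p : S p !=set0 by exists (b (q0^-1 * p)%g); exists q0.
have Sub p : has_ubound (S p).
  by exists 1 => _ [q _ <-]; case/andP: (b01 (q^-1 * p)%g).
have Sf p q : F q -> b (q^-1 * p)%g <= f p.
  by move=> Fq; apply: ub_le_sup => //; exists q.
have f01 p : 0 <= f p <= 1.
  apply/andP; split.
    by apply: le_trans (Sf p _ Fq0); case/andP: (b01 (q0^-1 * p)%g).
  by apply: ge_sup => // _ [q _ <-]; case/andP: (b01 (q^-1 * p)%g).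
exists f, N; split=> //.
- move=> q Fq; apply/eqP; rewrite eq_le; case/andP: (f01 q) => _ ->/=.
  by rewrite -b1 -(mulVg q); exact: Sf.
- move=> p; apply: contraPP => nq; apply/negP; rewrite negbK eq_le.
  case/andP: (f01 p) => -> _; rewrite andbT; apply: ge_sup => // _ [q Fq <-].
  have [->//|/bN Nq] := eqVneq (b (q^-1 * p)%g) 0.
  by exfalso; apply: nq; exists q.
- move=> e e0; move: (bu e e0); apply: filterS => u bue p.
  rewrite ler_distl lerBlDr; apply/andP; split.
    apply: ge_sup => // _ [q Fq <-]; rewrite -lerBlDr.
    apply: le_trans (Sf _ _ Fq); rewrite mulgA.
    by have := bue (q^-1 * p)%g; rewrite ler_distl => /andP[].
  apply: ge_sup => // _ [q Fq <-].
  apply: (@le_trans _ _ (b (q^-1 * p)%g + e)); last by rewrite lerD2r; exact: Sf.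
  by have := bue (q^-1 * p)%g; rewrite mulgA ler_distl => /andP[].
Qed.

End Bump.

(** * The coupling space *)

Section PointwiseTopology.
Context {P : eqType} {R : realType}.

Lemma ptws_eval_continuous (p : P) : continuous (fun f : {ptws P -> R} => f p).
Proof. exact: (@proj_continuous P (fun=> R) p). Qed.

Lemma continuous_to_ptws (T : topologicalType) (g : T -> {ptws P -> R}) :
  (forall p, continuous (fun t => g t p)) -> continuous g.
Proof.
by move=> cg t; apply/cvg_sup => p; exact: (continuous_comp_initial (cg p)).
Qed.

End PointwiseTopology.

(** Neighbourhoods in the initial topology contain preimages of open sets, so a point of [A] above a
    cluster point of the image filter is a cluster point of the filter. *)
Lemma compact_initial (S : choiceType) (T : topologicalType) (w : S -> T)
  (A : set (initial_topology w)) : compact (w @` A) -> compact A.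
Proof.
move=> cA F PF FA.
have [|_ [[a Aa <-] cla]] := cA (w @ F) (fmap_proper_filter w PF).
  by apply: (@filterS _ F _ A) FA => x Ax; exists x.
exists a; split=> // U V FU [_ [[W oW <-] /= Wa] WV].
have [||_ [[x Ux <-] Wx]] := cla (w @` U) W.
- by apply: (@filterS _ F _ U) FU => x Ux; exists x.
- by apply: open_nbhs_nbhs.
- by exists x; split=> //; exact: WV.
Qed.

Section PatternSpace.
Context {R : realType} {P : topologicalGroupType}.
Variable f0 : P -> R.

(* Each clause is a property inherited by all pointwise limits of left
   translates of f0. *)
Record pattern (f : P -> R) : Prop := {
  pattern_range : forall p, 0 <= f p <= 1 ;
  pattern_osc : forall u e, (forall p, `|f0 (p * u)%g - f0 p| <= e) ->
    forall p, `|f (p * u)%g - f p| <= e ;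
  pattern_supp : forall u, (forall p, f0 p = 0 \/ f0 (p * u)%g = 0) ->
    forall p, f p = 0 \/ f (p * u)%g = 0 ;
  pattern_dense : forall s : seq P,
    (forall p, f0 p = 0 \/ has (fun v => 2^-1 <= f0 (p * v)%g) s) ->
    forall p, f p = 0 \/ has (fun v => 2^-1 <= f (p * v)%g) s
}.

(** The premises of the clauses concern [f0] only. For fixed parameters each conclusion is a closed
    condition on finitely many coordinates: weak inequalities, equations and finite disjunctions of
    these. *)
Lemma pattern_closed : closed (pattern : set {ptws P -> R}).
Proof.
move=> f clf; pose ev p (g : {ptws P -> R}) := g p.
have cev p : continuous (ev p) by exact: ptws_eval_continuous.
have inC (C : set {ptws P -> R}) : closed C ->
      (forall g, pattern g -> C g) -> C f.
  by move=> clC pC; exact: (clC f (@closureS {ptws P -> R} pattern C pC f clf)).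
have cl_ge p (c : R) : closed [set g : {ptws P -> R} | c <= g p].
  by apply: (@preimage_closed _ _ (ev p) [set y | c <= y]);
    [move=> g _; exact: cev|exact: closed_ge].
have cl_le p (c : R) : closed [set g : {ptws P -> R} | g p <= c].
  by apply: (@preimage_closed _ _ (ev p) [set y | y <= c]);
    [move=> g _; exact: cev|exact: closed_le].
have cl_0 p : closed [set g : {ptws P -> R} | g p = 0].
  by apply: (@preimage_closed _ _ (ev p) [set y | y = 0]);
    [move=> g _; exact: cev|exact: closed_eq].
split.
- move=> p; apply/andP.
  apply: (inC ([set g : {ptws P -> R} | 0 <= g p] `&` [set g | g p <= 1])).
    exact: closedI.
  by move=> g [gr _ _ _]; apply/andP; exact: gr.
- move=> u e f0u p.
  apply: (inC [set g : {ptws P -> R} | `|g (p * u)%g - g p| <= e]).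
    apply: (@preimage_closed _ _ (fun g => `|ev (p * u)%g g - ev p g|)
      [set y | y <= e]); last exact: closed_le.
    move=> g _.
    have evB := cvgB (cev (p * u)%g g) (cev p g) _.
    have evN := cvg_norm (evB _); exact: evN.
  by move=> g [_ go _ _]; exact: go.
- move=> u f0u p.
  apply: (inC ([set g : {ptws P -> R} | g p = 0] `|` [set g | g (p * u)%g = 0])).
    exact: closedU.
  by move=> g [_ _ gs _]; exact: gs.
- move=> s f0s p.
  apply: (inC ([set g : {ptws P -> R} | g p = 0] `|`
    [set g : {ptws P -> R} | has (fun v => 2^-1 <= g (p * v)%g) s])).
    apply: closedU => //; elim: s {f0s} => [|v s IH] /=.
      have -> : [set g : {ptws P -> R} | false] = set0 by apply/seteqP; split.
      exact: closed0.
    have -> : [set g : {ptws P -> R} | (2^-1 <= g (p * v)%g) ||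
        has (fun v => 2^-1 <= g (p * v)%g) s] =
      [set g : {ptws P -> R} | 2^-1 <= g (p * v)%g] `|`
      [set g | has (fun v => 2^-1 <= g (p * v)%g) s].
      by apply/seteqP; split=> g /= /orP.
    exact: closedU.
  by move=> g [_ _ _ gd]; exact: gd.
Qed.

Lemma pattern_compact : compact (pattern : set {ptws P -> R}).
Proof.
apply: (@subclosed_compact {ptws P -> R} pattern
  [set f : {ptws P -> R} | forall p, `[0, 1]%classic (f p)]).
- exact: pattern_closed.
- by apply: (@tychonoff P (fun=> R) (fun=> `[0, 1]%classic)) => p; exact: segment_compact.
- by move=> f [fr _ _ _] p /=; rewrite in_itv; exact: fr.
Qed.

Definition shift (g : P) (f : P -> R) : P -> R := fun p => f (g^-1 * p)%g.

Lemma pattern_shift g f : pattern f -> pattern (shift g f).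
Proof.
move=> [fr fo fs fd]; split; rewrite /shift.
- by move=> p; exact: fr.
- by move=> u e /fo fu p; rewrite mulgA; exact: fu.
- by move=> u /fs fu p; rewrite mulgA; exact: fu.
- move=> s /fd fu p.
  by under eq_has do rewrite mulgA; exact: fu.
Qed.

(** The zero function satisfies all clauses and is fixed by every shift; it is removed to allow a
    proper action. *)
Definition pattern_set : set {ptws P -> R} :=
  [set f | pattern f /\ exists p, f p != 0].

Definition pattern_space := set_type pattern_set.
HB.instance Definition _ := Topological.on pattern_space.

Implicit Types x : pattern_space.

Definition pattern_val x : P -> R := set_val x.

Lemma pattern_valP x : pattern (pattern_val x).
Proof. by case: (set_valP x). Qed.

Lemma pattern_val_neq0 x : exists p, pattern_val x p != 0.
Proof. by case: (set_valP x). Qed.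

Lemma pattern_val_inj x y : pattern_val x =1 pattern_val y -> x = y.
Proof. by move=> xy; apply: val_inj; exact: funext. Qed.

Lemma pattern_val_continuous p : continuous (fun x => pattern_val x p).
Proof.
move=> x; apply: (@continuous_comp _ _ _ (set_val : pattern_space -> {ptws P -> R})
  (fun f : {ptws P -> R} => f p)).
  exact: initial_continuous.
exact: ptws_eval_continuous.
Qed.

Lemma pattern_space_hausdorff : hausdorff_space pattern_space.
Proof.
move=> x y xy; apply: pattern_val_inj => p; apply: (@Rhausdorff R) => A B xA yB.
have [] := xy ((fun x => pattern_val x p) @^-1` A)
  ((fun x => pattern_val x p) @^-1` B).
- exact: (pattern_val_continuous xA).
- exact: (pattern_val_continuous yB).
- by move=> z [Az Bz]; exists (pattern_val z p).
Qed.

(** A value at least [e > 0] already excludes the zero function, so this set is closed in the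
    compact set of all patterns. *)
Lemma pattern_space_compact p (e : R) : 0 < e ->
  compact [set x | e <= pattern_val x p].
Proof.
move=> e0; apply: compact_initial.
have -> : set_val @` [set x | e <= pattern_val x p] =
    pattern `&` [set f : {ptws P -> R} | e <= f p].
  apply/seteqP; split=> [_ [x ex <-]|f [pf ef]].
    by split=> //; exact: pattern_valP.
  have fX : pattern_set f.
    by split=> //; exists p; rewrite gt_eqF// (lt_le_trans e0).
  by exists (exist _ f (mem_set fX)).
apply: compact_closedI; first exact: pattern_compact.
apply: (@preimage_closed _ _ (fun f : {ptws P -> R} => f p) [set y | e <= y]).
  by move=> f _; exact: ptws_eval_continuous.
exact: closed_ge.
Qed.

Lemma pattern_space_locally_compact : locally_compact [set: pattern_space].
Proof.
move=> x _; have [p xp] := pattern_val_neq0 x.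
have xp0 : 0 < pattern_val x p.
  by rewrite lt_neqAle eq_sym xp; case/andP: (pattern_range (pattern_valP x) p).
exists [set y | pattern_val x p / 2 <= pattern_val y p].
  have : nbhs (pattern_val x p) [set r : R | pattern_val x p / 2 <= r].
    apply: (@filterS _ _ _ [set r : R | pattern_val x p / 2 < r]) => [r /ltW //|].
    apply: open_nbhs_nbhs; split; first exact: open_gt.
    by rewrite /= ltr_pdivrMr// ltr_pMr ?ltr1n.
  by rewrite withinET => /pattern_val_continuous.
have cU := @pattern_space_compact p _ (divr_gt0 xp0 (ltr0Sn R 1)).
by split=> //; apply: compact_closed => //; exact: pattern_space_hausdorff.
Qed.

Lemma pattern_set_shift g x : pattern_set (shift g (pattern_val x)).
Proof.
split; first exact/pattern_shift/pattern_valP.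
have [p xp] := pattern_val_neq0 x.
by exists (g * p)%g; rewrite /shift mulKg.
Qed.

Definition pattern_act g x : pattern_space :=
  exist _ (shift g (pattern_val x) : {ptws P -> R})
    (mem_set (pattern_set_shift g x)).

Lemma pattern_actE g x p : pattern_val (pattern_act g x) p = pattern_val x (g^-1 * p)%g.
Proof. by []. Qed.

Hypothesis f0u : left_uniform f0.

(** [pattern_osc] gives all patterns the modulus of [f0]: half of [e] pays for changing the function
    at [p], the other half for moving [p], uniformly in the function. *)
Lemma pattern_eval_continuous :
  continuous (fun xp : pattern_space * P => pattern_val xp.1 xp.2).
Proof.
move=> [x p]; apply/cvgrPdist_le => /= e e0.
have near_x : \forall y \near x, `|pattern_val x p - pattern_val y p| <= e / 2.
  have /cvgrPdist_le := @pattern_val_continuous p x.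
  by apply; rewrite divr_gt0.
have near_p : \forall q \near p, forall y : pattern_space,
    `|pattern_val y p - pattern_val y q| <= e / 2.
  have := nbhsVM p (f0u (divr_gt0 e0 (ltr0Sn R 1))).
  apply: filterS => q f0q y; rewrite distrC -[in X in `|X - _|](mulVKg p q).
  exact: (pattern_osc (pattern_valP y) f0q).
exists ([set y | `|pattern_val x p - pattern_val y p| <= e / 2],
  [set q | forall y : pattern_space, `|pattern_val y p - pattern_val y q| <= e / 2]) => //.
move=> [y q] [/= xy pq]; rewrite (splitr e).
apply: le_trans (ler_distD (pattern_val y p) _ _) _.
by apply: lerD.
Qed.

Lemma pattern_act_continuous :
  continuous (fun gx : P * pattern_space => pattern_act gx.1 gx.2).
Proof.
apply: continuous_comp_initial; apply: continuous_to_ptws => p [g x].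
apply: (@continuous_comp _ _ _ (fun gx : P * pattern_space => (gx.2,
    (gx.1^-1 * p)%g))
  (fun xp : pattern_space * P => pattern_val xp.1 xp.2)).
  apply: (@cvg_pair _ _ _ (nbhs (g, x)) (nbhs x) (nbhs (g^-1 * p)%g)).
    exact: cvg_snd.
  apply: (@cvgMg P _ (nbhs (g, x))
    (fun gx : P * pattern_space => gx.1^-1)%g (fun=> p) g^-1%g p).
    by apply: cvgVg; exact: cvg_fst.
  exact: cvg_cst.
exact: pattern_eval_continuous.
Qed.

End PatternSpace.

(** The transporter is the projection of a closed subset of [C * K]. *)
Lemma compact_transporter (A X : topologicalType) (act : A -> X -> X)
    (K : set X) (C : set A) : hausdorff_space X ->
  continuous (fun gx : A * X => act gx.1 gx.2) -> compact K -> compact C ->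
  [set g | [set act g x | x in K] `&` K !=set0] `<=` C ->
  compact [set g | [set act g x | x in K] `&` K !=set0].
Proof.
move=> hX cact cK cC sC.
have -> : [set g | [set act g x | x in K] `&` K !=set0] =
    fst @` ((C `*` K) `&` (fun gx : A * X => act gx.1 gx.2) @^-1` K).
  apply/seteqP; split=> [g gK|_ [[g x] [[_ /= Kx] Kgx] <-]]; last first.
    by exists (act g x); split=> //; exists x.
  have [_ [[x Kx <-] Kgx]] := gK; exists (g, x) => //; split=> //; split=> //.
  exact: sC.
apply: continuous_compact.
  by apply: continuous_subspaceT => p; exact: cvg_fst.
apply: compact_closedI; first exact: compact_setX.
by apply: preimage_closed; [move=> p _; exact: cact|exact: compact_closed].
Qed.

(** Not vanishing at a given point is an open condition, so the bound for a pair [p], [q] holds near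
    each pair of functions; compactness of [K * K] leaves a single compact set of possible [g]. *)
Lemma pattern_proper (R : realType) (P : topologicalGroupType) (f0 : P -> R)
    (A : topologicalType) (act : A -> pattern_space f0 -> pattern_space f0)
    (K : set (pattern_space f0)) :
  continuous (fun gx : A * pattern_space f0 => act gx.1 gx.2) ->
  (forall p q, exists2 C : set A, compact C & forall g x,
    pattern_val x p != 0 -> pattern_val (act g x) q != 0 -> C g) ->
  compact K -> compact [set g | [set act g x | x in K] `&` K !=set0].
Proof.
(* Along this filter [g] tends to infinity: its sets contain complements of compact sets. *)
move=> cact bact cK; pose F := filter_from (@compact A) (fun C => ~` C).
have FF : Filter F.
  apply: filter_from_filter; first by exists set0; exact: compact0.
  move=> C D cC cD; exists (C `|` D); first exact: compactU.
  by rewrite setCU.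
have near_neq0 (x : pattern_space f0) p : pattern_val x p != 0 ->
    \forall y \near x, pattern_val y p != 0.
  move=> xp; have : nbhs (pattern_val x p) [set r : R | r != 0].
    by apply: open_nbhs_nbhs; split=> //; exact: open_neq.
  by move=> /pattern_val_continuous.
have /compact_near_coveringP := compact_setX cK cK.
move=> /(_ A F (fun g xy => act g xy.1 <> xy.2) FF) [].
  move=> [x y] _; have [p xp] := pattern_val_neq0 x.
  have [q yq] := pattern_val_neq0 y; have [C cC pqC] := bact p q.
  exists ([set xy | pattern_val xy.1 p != 0 /\ pattern_val xy.2 q != 0], ~` C).
    split=> /=; last by exists C.
    exists ([set z | pattern_val z p != 0], [set z | pattern_val z q != 0]) => //=.
    by split; exact: near_neq0.
  by move=> [[z w] g] [/= [zp wq] nCg] gzw; apply/nCg/(pqC g z) => //; rewrite gzw.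
move=> C cC CK; apply: compact_transporter cC _ => //.
  exact: pattern_space_hausdorff.
move=> g [_ [[x Kx <-] Kgx]]; apply: contrapT => nCg.
exact: (CK g nCg (x, act g x)).
Qed.

(** * From correspondences to couplings *)

(** For two support points with displacement [(u, w)], a given [u] confines [w]: [a^-1 * a'] lies in
    [M u M^-1], hence [c^-1 * c'] in [B], hence [w] in [N^-1 B N]. *)
Lemma controlled_support (G H : topologicalGroupType) (F : G -> H -> Prop)
    (M : set G) (N : set H) (u : G) : controlled F -> compact M -> compact N ->
  exists2 C : set H, compact C & forall a a' c c' s t w, F a c -> F a' c' ->
    M (a^-1 * s)%g -> N (c^-1 * t)%g -> M (a'^-1 * (s * u))%g ->
    N (c'^-1 * (t * w))%g -> C w.
Proof.
move=> FC cM cN.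
have [|B cB FB] := FC [set m * m' | m in [set m * m' | m in M & m' in [set u]]
    & m' in [set m^-1 | m in M]]%g.
  by apply: compactM (compactV cM); apply: compactM => //; exact: compact_set1.
exists [set n * n' | n in [set n * n' | n in [set n^-1 | n in N] & n' in B]
    & n' in N]%g.
  by apply: compactM => //; apply: compactM => //; exact: compactV.
move=> a a' c c' s t w Fac Fac' Ms Nt Msu Ntw.
have Bcc' : B (c^-1 * c')%g.
  apply: FB Fac Fac' _; exists (a^-1 * s * u)%g.
    by exists (a^-1 * s)%g => //; exists u.
  exists (a'^-1 * (s * u))^-1%g; first by exists (a'^-1 * (s * u))%g.
  by rewrite !invgM invgK !mulgA !mulgK.
exists ((c^-1 * t)^-1 * (c^-1 * c'))%g.
  exists (c^-1 * t)^-1%g; first by exists (c^-1 * t)%g.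
  by exists (c^-1 * c')%g.
exists (c'^-1 * (t * w))%g => //.
by rewrite invgM invgK -!mulgA !mulVKg mulKg.
Qed.

(** Choose [c'] related to [s * g], where [f] equals 1. The step [t^-1 * c'] lies in the compact set
    [N^-1 B], and replacing it by a point of a finite net costs at most one half. *)
Lemma controlled_dense (R : realType) (G H : topologicalGroupType)
    (F : G -> H -> Prop) (f : G -> H -> R) (M : set G) (N : set H) (g : G) :
  (forall a, exists c, F a c) -> controlled F -> compact M -> compact N ->
  (forall s t, f s t != 0 -> exists a c, [/\ F a c, M (a^-1 * s)%g &
    N (c^-1 * t)%g]) ->
  (forall a c, F a c -> f a c = 1) ->
  (\forall v \near (1%g : H), forall s t, `|f s (t * v)%g - f s t| <= 2^-1) ->
  exists r : seq H, forall s t,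
    f s t = 0 \/ has (fun v => 2^-1 <= f (s * g)%g (t * v)%g) r.
Proof.
move=> Ft FC cM cN fMN f1 fu.
have [|B cB FB] := FC [set m * m' | m in M & m' in [set g]]%g.
  by apply: compactM => //; exact: compact_set1.
have cNB : compact [set n * n' | n in [set n^-1 | n in N] & n' in B]%g.
  by apply: compactM => //; exact: compactV.
have [r rNB] := compact_finite_net cNB fu; exists r => s t.
have [|/fMN [a [c [Fac Ms Nt]]]] := eqVneq (f s t) 0; [by left|right].
have [c' Fc'] := Ft (s * g)%g.
have [|v vr fv] := rNB (t^-1 * c')%g.
  exists (c^-1 * t)^-1%g; first by exists (c^-1 * t)%g.
  exists (c^-1 * c')%g; last by rewrite invgM invgK -mulgA mulVKg.
  apply: FB Fac Fc' _; exists (a^-1 * s)%g => //; exists g => //.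
  by rewrite mulgA.
apply/hasP; exists v => //.
have := fv (s * g)%g (t * v)%g.
rewrite -mulgA mulVKg mulVKg f1// ler_distl => /andP[_].
by rewrite -lerBlDr; apply: le_trans; lra.
Qed.

Lemma mulg_pair (G H : groupType) (a c : G) (b d : H) :
  ((a, b) * (c, d) = (a * c, b * d))%g.
Proof. by []. Qed.

Section CorrespondenceCoupling.
Context {R : realType} {G H : topologicalGroupType}.
Hypotheses (hG : hausdorff_space G) (hH : hausdorff_space H).
Hypotheses (lG : locally_compact [set: G]) (lH : locally_compact [set: H]).

Lemma correspondence_coupling (F : G -> H -> Prop) : coarse_correspondence F ->
  exists (X : topologicalType) (lact : G -> X -> X) (ract : X -> H -> X),
    topological_coupling lact ract.
Proof.
move=> [Ft Fo FC FcC].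
have [c1 F1] := Ft 1%g.
have [f0 [N [cN f01 f0F f0N f0u]]] := @thickened_indicator R _
  (hausdorff_setX hG hH) (locally_compact_setX lG lH)
  [set ac : G * H | F ac.1 ac.2] (ex_intro _ (1%g, c1) F1).
pose N1 := fst @` N; pose N2 := snd @` N.
have cN1 : compact N1.
  by apply: continuous_compact cN; apply: continuous_subspaceT => p; exact: cvg_fst.
have cN2 : compact N2.
  by apply: continuous_compact cN; apply: continuous_subspaceT => p; exact: cvg_snd.
have f0supp s t : f0 (s, t) != 0 ->
    exists a c, [/\ F a c, N1 (a^-1 * s)%g & N2 (c^-1 * t)%g].
  move=> /f0N [[a c] Fac Nst]; exists a, c; split=> //.
    by exists ((a, c)^-1 * (s, t))%g.
  by exists ((a, c)^-1 * (s, t))%g.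
have f0suppC t s : f0 (s, t) != 0 ->
    exists c a, [/\ F a c, N2 (c^-1 * t)%g & N1 (a^-1 * s)%g].
  by move=> /f0supp [a [c []]]; exists c, a.
pose X := pattern_space f0.
pose lact (g : G) (x : X) := pattern_act ((g, 1) : G * H)%g x.
(* The inverse turns the left action of [H] into a right one. *)
pose ract (x : X) (h : H) := pattern_act ((1, h^-1) : G * H)%g x.
have lactE g x s t : pattern_val (lact g x) (s, t) = pattern_val x (g^-1 * s, t)%g.
  by rewrite pattern_actE; congr (pattern_val x (_, _)); rewrite /= invg1 mul1g.
have ractE x h s t : pattern_val (ract x h) (s, t) = pattern_val x (s, h * t)%g.
  by rewrite pattern_actE; congr (pattern_val x (_, _)); rewrite /= ?invgK ?invg1 ?mul1g.
(* Any displacement between two nonzero points of [x] also occurs in [f0], by the contrapositive of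
   [pattern_supp]. *)
have suppX (x : X) p q : pattern_val x p != 0 -> pattern_val x q != 0 ->
    exists2 r, f0 r != 0 & f0 (r * (p^-1 * q))%g != 0.
  move=> xp xq; apply: contrapT => nr.
  have supp r : f0 r = 0 \/ f0 (r * (p^-1 * q))%g = 0.
    have [|r0] := eqVneq (f0 r) 0; [by left|right].
    by apply/eqP; apply: contrapT => /negP rpq; apply: nr; exists r.
  have [/eqP|] := pattern_supp (pattern_valP x) supp p; first by rewrite (negPf xp).
  by rewrite mulVKg => /eqP; rewrite (negPf xq).
have lcont : continuous (fun gx : G * X => lact gx.1 gx.2).
  move=> [g x].
  apply: (@continuous_comp _ _ _ (fun gx : G * X => (((gx.1, 1) : G * H)%g, gx.2))
    (fun gx : (G * H) * X => pattern_act gx.1 gx.2));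
    last exact: pattern_act_continuous.
  apply: (@cvg_pair _ _ _ (nbhs (g, x)) (nbhs ((g, 1) : G * H)%g) (nbhs x));
    last exact: cvg_snd.
  apply: (@cvg_pair _ _ _ (nbhs (g, x)) (nbhs g) (nbhs (1%g : H)));
    first exact: cvg_fst.
  exact: cvg_cst.
have rcont : continuous (fun hx : H * X => ract hx.2 hx.1).
  move=> [h x].
  apply: (@continuous_comp _ _ _ (fun hx : H * X => (((1, hx.1^-1) : G * H)%g, hx.2))
    (fun gx : (G * H) * X => pattern_act gx.1 gx.2));
    last exact: pattern_act_continuous.
  apply: (@cvg_pair _ _ _ (nbhs (h, x)) (nbhs ((1, h^-1) : G * H)%g) (nbhs x));
    last exact: cvg_snd.
  apply: (@cvg_pair _ _ _ (nbhs (h, x)) (nbhs (1%g : G)) (nbhs (h^-1)%g));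
    first exact: cvg_cst.
  by apply: cvgVg; exact: cvg_fst.
have near1 : \forall u \near (1%g : G * H), forall p, `|f0 (p * u)%g - f0 p| <= 2^-1.
  exact: f0u.
exists X, lact, ract; split.
- have F0 : pattern_set f0 f0.
    by split=> //; exists (1%g, c1); rewrite f0F ?oner_neq0.
  by exists (exist _ (f0 : {ptws (G * H)%type -> R}) (mem_set F0)).
- exact: pattern_space_hausdorff.
- exact: pattern_space_locally_compact.
- split=> [x|g g' x]; apply: pattern_val_inj => -[s t]; rewrite !lactE.
    by rewrite invg1 mul1g.
  by rewrite invgM mulgA.
- split=> [x|x h k]; apply: pattern_val_inj => -[s t]; rewrite !ractE.
    by rewrite mul1g.
  by rewrite mulgA.
- by move=> g x h; apply: pattern_val_inj => -[s t]; rewrite !(ractE, lactE).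
- exact: lcont.
- move=> [x h]; apply: (@continuous_comp _ _ _ (fun xh : X * H => (xh.2, xh.1))
    (fun hx : H * X => ract hx.2 hx.1)); last exact: rcont.
  by apply: (@cvg_pair _ _ _ (nbhs (x, h)) (nbhs h) (nbhs x));
    [exact: cvg_snd|exact: cvg_fst].
- move=> K; apply: pattern_proper => // -[x y] [x' y'].
  (* If [f] is nonzero at [(x, y)] and at [(g^-1 * x', y')], the [H]-displacement [y^-1 * y'] is
     given, so [w = x^-1 * g^-1 * x'] stays in [C], and [g = x' * w^-1 * x^-1]. *)
  have [C cC FCC] := controlled_support (y^-1 * y')%g FcC cN2 cN1.
  exists [set g * g' | g in [set x'] & g' in
    [set g * g' | g in [set g^-1 | g in C] & g' in [set x^-1]]]%g.
    apply: compactM; first exact: compact_set1.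
    by apply: compactM; [exact: compactV|exact: compact_set1].
  move=> g f fp; rewrite lactE => fq.
  have [[s t] f0st f0st'] := suppX f _ _ fp fq.
  have [a [c [Fac N1s N2t]]] := f0supp _ _ f0st.
  have [a' [c' [Fac' N1s' N2t']]] := f0supp _ _ f0st'.
  have Cw := FCC _ _ _ _ _ _ _ Fac Fac' N2t N1s N2t' N1s'.
  exists x' => //; exists ((x^-1 * (g^-1 * x'))^-1 * x^-1)%g.
    exists (x^-1 * (g^-1 * x'))^-1%g; first by exists (x^-1 * (g^-1 * x'))%g.
    by exists x^-1%g.
  by rewrite !invgM !invgK !mulgA mulgV mul1g mulgK.
- move=> K; apply: (@pattern_proper _ _ f0 H (fun h x => ract x h)) => // -[x y] [x' y'].
  (* Here the [G]-displacement is given, [w = y^-1 * h * y'] stays in [C], and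
     [h = y * w * y'^-1]. *)
  have [C cC FCC] := controlled_support (x^-1 * x')%g FC cN1 cN2.
  exists [set h * h' | h in [set h * h' | h in [set y] & h' in C]
    & h' in [set y'^-1]]%g.
    by apply: compactM; [apply: compactM => //; exact: compact_set1|exact: compact_set1].
  move=> h f fp; rewrite ractE => fq.
  have [[s t] f0st f0st'] := suppX f _ _ fp fq.
  have [a [c [Fac N1s N2t]]] := f0supp _ _ f0st.
  have [a' [c' [Fac' N1s' N2t']]] := f0supp _ _ f0st'.
  have Cw := FCC _ _ _ _ _ _ _ Fac Fac' N1s N2t N1s' N2t'.
  exists (y * (y^-1 * (h * y')))%g.
    by exists y => //; exists (y^-1 * (h * y'))%g.
  by exists y'^-1%g => //; rewrite mulVKg mulgK.
(* Each action only has to bring a point of value at least one half to the identity; [G] can do so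
   from the line with [H]-coordinate 1, and [H] from the line with [G]-coordinate 1. *)
exists [set x : X | 2^-1 <= pattern_val x (1, 1)%g]; split.
- exact: pattern_space_compact.
- apply/seteqP; split=> // x _; have [[s t] xst] := pattern_val_neq0 x.
  have near2 : \forall u \near (1%g : G), forall t s,
      `|f0 ((s * u)%g, t) - f0 (s, t)| <= 2^-1.
    have : (fun u : G => (u, 1%g) : G * H) @ (1%g : G) --> (1%g : G * H).
      apply: (@cvg_pair _ _ _ (nbhs (1%g : G)) (nbhs (1%g : G)) (nbhs (1%g : H))).
        exact: cvg_id.
      exact: cvg_cst.
    move=> /(_ _ near1) near1G; near=> u => t' s'.
    have fu p : `|f0 (p * (u, 1%g))%g - f0 p| <= 2^-1 by move: p; near: u.
    by have := fu (s', t'); rewrite mulg_pair mulg1.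
  (* The displacement [t^-1] leads from [(s, t)] to the line with [H]-coordinate 1; [pattern_dense]
     transfers the finite net from [f0] to [x]. *)
  have [r fr] := controlled_dense (f := fun t s => f0 (s, t)) t^-1%g
    Fo FcC cN2 cN1 f0suppC (fun c a => f0F (a, c)) near2.
  have /(pattern_dense (pattern_valP x)) xr : forall p : G * H, f0 p = 0 \/
      has (fun v => 2^-1 <= f0 (p * v)%g) [seq (v, t^-1%g) | v <- r].
    by move=> [s' t']; rewrite has_map; exact: fr.
  have [/eqP|] := xr (s, t); first by rewrite (negPf xst).
  rewrite has_map => /hasP [v vr /= xv].
  exists (s * v)%g => //; exists (lact (s * v)^-1%g x).
    rewrite /= lactE invgK mulg1.
    by move: xv; rewrite mulg_pair mulgV.
  by apply: pattern_val_inj => -[? ?]; rewrite !lactE invgK mulVKg.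
- apply/seteqP; split=> // x _; have [[s t] xst] := pattern_val_neq0 x.
  have near2 : \forall u \near (1%g : H), forall s t,
      `|f0 (s, (t * u)%g) - f0 (s, t)| <= 2^-1.
    have : (fun u : H => (1%g, u) : G * H) @ (1%g : H) --> (1%g : G * H).
      apply: (@cvg_pair _ _ _ (nbhs (1%g : H)) (nbhs (1%g : G)) (nbhs (1%g : H))).
        exact: cvg_cst.
      exact: cvg_id.
    move=> /(_ _ near1) near1H; near=> u => s' t'.
    have fu p : `|f0 (p * (1%g, u))%g - f0 p| <= 2^-1 by move: p; near: u.
    by have := fu (s', t'); rewrite mulg_pair mulg1.
  have [r fr] := controlled_dense (f := fun s t => f0 (s, t)) s^-1%g
    Ft FC cN1 cN2 f0supp (fun a c => f0F (a, c)) near2.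
  have /(pattern_dense (pattern_valP x)) xr : forall p : G * H, f0 p = 0 \/
      has (fun v => 2^-1 <= f0 (p * v)%g) [seq (s^-1%g, v) | v <- r].
    by move=> [s' t']; rewrite has_map; exact: fr.
  have [/eqP|] := xr (s, t); first by rewrite (negPf xst).
  rewrite has_map => /hasP [v vr /= xv].
  exists (ract x (t * v)%g).
    rewrite /= ractE mulg1.
    by move: xv; rewrite mulg_pair mulgV.
  exists (t * v)^-1%g => //.
  by apply: pattern_val_inj => -[? ?]; rewrite !ractE mulVKg.
Unshelve. all: by end_near. Qed.

End CorrespondenceCoupling.

Theorem corollary2 (R : realType) (G H : topologicalGroupType)
  (G_hausdorff : hausdorff_space G) (H_hausdorff : hausdorff_space H)
  (G_locally_compact : locally_compact [set: G])
  (H_locally_compact : locally_compact [set: H])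
  (G_second_countable : @second_countable G)
  (H_second_countable : @second_countable H)
  (G_compactly_generated : compactly_generated G)
  (H_compactly_generated : compactly_generated H) :
  quasi_isometric R G H <->
  exists (X : topologicalType) (lact : G -> X -> X) (ract : X -> H -> X),
    topological_coupling lact ract.
Proof.
split=> [GH|[X [lact [ract coup]]]].
  have [F corrF] := quasi_isometric_correspondence G_hausdorff H_hausdorff
    G_locally_compact H_locally_compact GH.
  exact: (@correspondence_coupling R _ _ _ _ _ _ F).
have [F corrF] := coupling_correspondence coup.
exact: (correspondence_quasi_isometric _ _ _ _ _ _ corrF).
Qed.
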